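(* Let $k=\mathbf{C}$, let $Q,Q'$ be finite quivers with rational weights $\theta,\theta'$ and dimension vectors $d,d'$ (all components positive), and let $\overline{\theta}=(\theta_a+\theta'_{a'})_{(a,a')}$ and $\bar d=(d_ad'_{a'})_{(a,a')}$ for $Q\otimes Q'$. Assume $d$ is coprime and $\theta$-coprime, $d'$ is coprime and $\theta'$-coprime, and $\bar d$ is $\overline{\theta}$-coprime. Let $N_1,N_2,N_3$ be the complex analytic moduli spaces of semistable (equivalently stable) representations of $(Q,\theta,d)$, $(Q',\theta',d')$, $(Q\otimes Q',\overline{\theta},\bar d)$ respectively. Let $n,n'$ be integers with $n(\mu_\theta(d)-\theta_a)\in\mathbf{Z}$ for all $a\in Q_0$ and $n'(\mu_{\theta'}(d')-\theta'_{a'})\in\mathbf{Z}$ for all $a'\in Q'_0$, put $\bar n=nn'$, and let $F_1,F_2,F_3$ be the natural holomorphic line bundles on $N_1,N_2,N_3$ defined using $n,n',\bar n$ respectively. Let $\bar\phi:N_1\times N_2\to N_3$ be the holomorphic map induced by the tensor product of representations. Then the line bundles $\bar\phi^*F_3$ and $$\mathrm{pr}_1^*\big(F_1^{\otimes n'\,\mathrm{rk}(d')}\big)\otimes\mathrm{pr}_2^*\big(F_2^{\otimes n\,\mathrm{rk}(d)}\big)$$ on $N_1\times N_2$ are isomorphic, where $\mathrm{pr}_j:N_1\times N_2\to N_j$ ($j=1,2$) is the projection map.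
   Context: Quivers and stability. A quiver $Q=(Q_0,Q_1,\mathrm{s},\mathrm{t})$ consists of finite sets $Q_0\neq\emptyset$, $Q_1$ and source and target maps $\mathrm{s},\mathrm{t}:Q_1\to Q_0$. A representation is a family $(V_a)_{a\in Q_0}$ of finite-dimensional vector spaces with linear maps $\rho_\alpha:V_{\mathrm{s}(\alpha)}\to V_{\mathrm{t}(\alpha)}$; its type is $(\dim V_a)_a$. For $0\ne d\in\mathbf{N}^{Q_0}$ and a weight $\theta\in\mathbf{R}^{Q_0}$: $\mathrm{rk}(d)=\sum_a d_a$, $\mu_\theta(d)=\left(\sum_a\theta_ad_a\right)/\mathrm{rk}(d)$; the slope of a non-zero representation is the slope of its type. A non-zero representation is $\theta$-semistable (resp. $\theta$-stable) if every non-zero proper subrepresentation has slope $\le$ (resp. $<$) its slope. $d$ is coprime if $\gcd(d_a\mid a\in Q_0)=1$, and $\theta$-coprime if $\mu_\theta(e)\neq\mu_\theta(d)$ for all $0<e<d$ in $\mathbf{N}^{Q_0}$ (componentwise order). Internal product. $Q\otimes Q'$ has vertices $Q_0\times Q_0'$ and arrows $(Q_0\times Q_1')\sqcup(Q_1\times Q_0')$, with $(a,\alpha')$ going from $(a,\mathrm{s}(\alpha'))$ to $(a,\mathrm{t}(\alpha'))$ and $(\alpha,a')$ from $(\mathrm{s}(\alpha),a')$ to $(\mathrm{t}(\alpha),a')$. Moduli spaces. Fix $V_a$ with $\dim V_a=d_a$. Let $\mathcal{A}_1=\bigoplus_{\alpha\in Q_1}\mathrm{Hom}(V_{\mathrm{s}(\alpha)},V_{\mathrm{t}(\alpha)})$,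 $G_1=\prod_{a\in Q_0}\mathrm{Aut}(V_a)$ acting on the right by $(\rho g)_\alpha=g_{\mathrm{t}(\alpha)}^{-1}\circ\rho_\alpha\circ g_{\mathrm{s}(\alpha)}$, $\Delta_1=\{(c\mathbf{1}_{V_a})_a\mid c\in\mathbf{C}^\times\}$, $\bar G_1=\Delta_1\backslash G_1$, and let $\mathcal{A}_1^{\mathrm{s}}$ be the set of $\rho$ with $(V,\rho)$ $\theta$-stable (equal to the semistable locus since $d$ is $\theta$-coprime). $N_1$ is the quotient complex space of $\mathcal{A}_1^{\mathrm{s}}$ by $\bar G_1$, with quotient map $p_1:\mathcal{A}_1^{\mathrm{s}}\to N_1$, a holomorphic principal $\bar G_1$-bundle. Define $\mathcal{A}_2,G_2,\bar G_2,p_2,N_2$ in the same way from $(Q',\theta',d')$ and fixed spaces $W_{a'}$ with $\dim W_{a'}=d'_{a'}$, and $\mathcal{A}_3,G_3,\bar G_3,p_3,N_3$ from $(Q\otimes Q',\overline{\theta},\bar d)$ and the spaces $V_a\otimes W_{a'}$. The map $\bar\phi$. Let $\phi:\mathcal{A}_1\times\mathcal{A}_2\to\mathcal{A}_3$, $\phi(\rho,\sigma)=\big((\rho_\alpha\otimes\mathbf{1}_{W_{a'}})_{(\alpha,a')},(\mathbf{1}_{V_a}\otimes\sigma_{\alpha'})_{(a,\alpha')}\big)$. It maps $\mathcal{A}_1^{\mathrm{s}}\times\mathcal{A}_2^{\mathrm{s}}$ into $\mathcal{A}_3^{\mathrm{s}}$, and $\bar\phi:N_1\times N_2\to N_3$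 is the unique holomorphic map with $\bar\phi\circ(p_1\times p_2)=p_3\circ\phi$. The natural line bundles. Let $\chi_1(g)=\prod_{a}\det(g_a)^{n(\mu_\theta(d)-\theta_a)}$ on $G_1$, and let $G_1$ act on the trivial bundle $E_1=\mathcal{A}_1\times\mathbf{C}$ by $(\rho,v)g=(\rho g,\chi_1(g)^{-1}v)$; $\Delta_1$ acts trivially, so this is a $\bar G_1$-action. $F_1$ is the holomorphic line bundle on $N_1$ (unique up to isomorphism) such that $p_1^*F_1$ is $\bar G_1$-isomorphic to $E_1|_{\mathcal{A}_1^{\mathrm{s}}}$. Likewise $F_2$ on $N_2$ and $F_3$ on $N_3$ are defined by the characters $\chi_2(g')=\prod_{a'}\det(g'_{a'})^{n'(\mu_{\theta'}(d')-\theta'_{a'})}$ of $G_2$ and $\chi_3(h)=\prod_{(a,a')}\det(h_{(a,a')})^{\bar n(\mu_{\overline{\theta}}(\bar d)-\overline{\theta}_{(a,a')})}$ of $G_3$. *)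

(* Defs.v *)
From HB Require Import structures.
From mathcomp Require Import all_boot all_order all_algebra.
From mathcomp Require Import complex mxtens.
From mathcomp Require Import all_classical all_reals all_analysis.

Set Implicit Arguments.
Unset Strict Implicit.
Unset Printing Implicit Defensive.

Import Order.TTheory GRing.Theory Num.Theory.
Import numFieldNormedType.Exports.

Local Open Scope classical_set_scope.
Local Open Scope ring_scope.

(* R[i] is packed as a numFieldType: the normed and topological structures of
   MathComp-Analysis are not inferred on the bare carrier R[i]. *)
Definition cplx (R : realType) : numFieldType := R[i]%C.

Record quiver := Quiver {
  vert : finType;
  arr : finType;
  src : arr -> vert;
  tgt : arr -> vert;
  vert_gt0 : (0 < #|vert|)%N }.

Section Weights.
Variable Q : quiver.
Implicit Types (theta : vert Q -> rat) (d e : vert Q -> nat).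

Definition rk d : nat := (\sum_a d a)%N.

Definition slope theta d : rat := (\sum_a theta a * (d a)%:R) / (rk d)%:R.

Definition coprime_dim d : Prop := (\big[gcdn/0]_a d a)%N = 1%N.

Definition theta_coprime theta d : Prop :=
  forall e, (forall a, e a <= d a)%N ->
    (exists a, 0 < e a)%N -> (exists a, e a < d a)%N ->
    slope theta e != slope theta d.

End Weights.

Section InternalProduct.
Variables Q Q' : quiver.

Lemma internal_product_vert_gt0 : (0 < #|{: vert Q * vert Q'}|)%N.
Proof. by rewrite card_prod muln_gt0 !vert_gt0. Qed.

Definition internal_product : quiver := @Quiver
  (vert Q * vert Q')%type
  ((vert Q * arr Q') + (arr Q * vert Q'))%type
  (fun g => match g with
            | inl p => (p.1, src p.2) | inr p => (src p.1, p.2) end)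
  (fun g => match g with
            | inl p => (p.1, tgt p.2) | inr p => (tgt p.1, p.2) end)
  internal_product_vert_gt0.

Definition product_weight (theta : vert Q -> rat) (theta' : vert Q' -> rat) :
  vert internal_product -> rat := fun p => theta p.1 + theta' p.2.

Definition product_dim (d : vert Q -> nat) (d' : vert Q' -> nat) :
  vert internal_product -> nat := fun p => (d p.1 * d' p.2)%N.

End InternalProduct.

(* Complex manifolds, given by atlases of charts with values in C^m.  A chart
   is a pair (U, phi) of which only the values of phi on U are relevant. *)
Section Manifolds.
Variable R : realType.
Local Notation C := (cplx R).

Record charted_space := ChartedSpace {
  cs_top :> topologicalType;
  cs_dim : nat;
  cs_chart : set (set cs_top * (cs_top -> 'rV[C]_cs_dim)) }.

(* Holomorphy is complex (Frechet) differentiability on a neighbourhood. *)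
Definition hol_at (M : charted_space) (E : normedModType C) (f : M -> E)
    (x : M) : Prop :=
  forall U phi, cs_chart (U, phi) -> U x ->
    exists g : 'rV[C]_(cs_dim M) -> E,
      (\forall v \near phi x, differentiable g v) /\
      (\forall y \near x, f y = g (phi y)).

Definition hol_map_at (M N : charted_space) (f : M -> N) (x : M) : Prop :=
  {for x, continuous f} /\
  forall V psi, cs_chart (V, psi) -> V (f x) -> hol_at (psi \o f) x.

Record hol_map (M N : charted_space) := HolMap {
  hol_fun :> M -> N;
  hol_funP : forall x, hol_map_at hol_fun x }.

Record complex_manifold := ComplexManifold {
  cm_space :> charted_space;
  cm_hausdorff : hausdorff_space cm_space;
  cm_cover : forall x : cm_space, exists U phi, cs_chart (U, phi) /\ U x;
  cm_open : forall U phi, @cs_chart cm_space (U, phi) -> open U;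
  cm_inj : forall U phi, @cs_chart cm_space (U, phi) -> {in U &, injective phi};
  cm_continuous : forall U phi, @cs_chart cm_space (U, phi) ->
    forall x, U x -> {for x, continuous phi};
  cm_open_map : forall U phi, @cs_chart cm_space (U, phi) ->
    forall W, open W -> W `<=` U -> open (phi @` W);
  cm_transition : forall U phi, @cs_chart cm_space (U, phi) ->
    forall x, U x -> hol_at phi x }.

Definition sub_space n (A : set 'rV[C]_n) : charted_space :=
  @ChartedSpace A n [set (setT, set_val)].

Definition prod_space (M N : charted_space) : charted_space :=
  @ChartedSpace (M * N)%type (cs_dim M + cs_dim N)
    [set c | exists U phi V psi,
      [/\ @cs_chart M (U, phi), @cs_chart N (V, psi) &
          c = (U `*` V, fun z => row_mx (phi z.1) (psi z.2))]].

Lemma hol_at_cst (M : charted_space) (E : normedModType C) (c : E) (x : M) :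
  hol_at (fun=> c) x.
Proof.
move=> U phi _ _; exists (fun=> c); split; last by near=> y.
by near=> v; exact: differentiable_cst.
Unshelve. all: by end_near. Qed.

Lemma hol_at_div (M : charted_space) (f g : M -> C) (x : M) :
  hol_at f x -> hol_at g x -> g x != 0 -> hol_at (fun y => f y / g y) x.
Proof.
move=> hf hg gx0 U phi cU Ux.
have [f1 [df ef]] := hf U phi cU Ux; have [g1 [dg eg]] := hg U phi cU Ux.
have g1x : g1 (phi x) != 0 by rewrite -(nbhs_singleton eg).
have g1c : {for phi x, continuous g1}.
  by apply: differentiable_continuous; exact: nbhs_singleton dg.
exists (fun v => f1 v / g1 v); split.
  have nz : \forall v \near phi x, g1 v != 0.
    exact: (cvgr_neq0 _ g1c g1x).
  near=> v; apply: differentiableM; first by near: v.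
  by apply: differentiableV; near: v.
by near=> y; rewrite (near ef y _) ?(near eg y _).
Unshelve. all: by end_near. Qed.

Lemma hol_at_comp (M : charted_space) (N : complex_manifold)
    (E : normedModType C) (F : M -> N) (f : N -> E) (x : M) :
  hol_map_at F x -> hol_at f (F x) -> hol_at (f \o F) x.
Proof.
move=> [Fc Fh] hf U phi cU Ux.
have [V [psi [cV Vx]]] := cm_cover (F x).
have [G [dG eG]] := Fh V psi cV Vx U phi cU Ux.
have [g [dg eg]] := hf V psi cV Vx.
have GcE : {for phi x, continuous G}.
  by apply: differentiable_continuous; exact: nbhs_singleton dG.
have GE : G (phi x) = psi (F x) by rewrite -(nbhs_singleton eG).
exists (g \o G); split.
  have dg' : \forall v \near phi x, differentiable g (G v).
    by apply: (GcE (fun w => differentiable g w)); rewrite GE.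
  near=> v; apply: differentiable_comp; near: v; [exact: dG|exact: dg'].
have eg' : \forall y \near x, f (F y) = g (psi (F y)).
  exact: (Fc (fun z => f z = g (psi z))).
near=> y; rewrite /= (near eg' y _) //.
by have /= -> // := near eG y _.
Unshelve. all: by end_near. Qed.

Lemma near_differentiable_lsubmx m n (E : normedModType C)
    (g : 'rV[C]_m -> E) (u : 'rV[C]_m) (w : 'rV[C]_n) :
  (\forall a \near u, differentiable g a) ->
  \forall a \near row_mx u w, differentiable (g \o lsubmx) a.
Proof.
move=> dg.
have lc : {for row_mx u w, continuous (@lsubmx C 1 m n)}.
  exact/differentiable_continuous/differentiable_lsubmx.
have dg' : \forall a \near row_mx u w, differentiable g (lsubmx a).
  by apply: (lc (fun a => differentiable g a)); rewrite row_mxKl.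
apply: filterS dg' => a dga.
by apply: differentiable_comp; [exact: differentiable_lsubmx|exact: dga].
Qed.

Lemma near_differentiable_rsubmx m n (E : normedModType C)
    (g : 'rV[C]_n -> E) (u : 'rV[C]_m) (w : 'rV[C]_n) :
  (\forall a \near w, differentiable g a) ->
  \forall a \near row_mx u w, differentiable (g \o rsubmx) a.
Proof.
move=> dg.
have lc : {for row_mx u w, continuous (@rsubmx C 1 m n)}.
  exact/differentiable_continuous/differentiable_rsubmx.
have dg' : \forall a \near row_mx u w, differentiable g (rsubmx a).
  by apply: (lc (fun a => differentiable g a)); rewrite row_mxKr.
apply: filterS dg' => a dga.
by apply: differentiable_comp; [exact: differentiable_rsubmx|exact: dga].
Qed.

Lemma fst_hol (M N : complex_manifold) (z : prod_space M N) :
  @hol_map_at (prod_space M N) M fst z.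
Proof.
split; first exact: cvg_fst.
move=> V psi cV Vz W chi [U [phi [U' [phi' [cU cU' [-> ->]]]]]] [/= Uz U'z].
have [g [dg eg]] := cm_transition cV Vz cU Uz.
exists (g \o lsubmx); split => /=.
  exact: near_differentiable_lsubmx.
have eg' : \forall y \near z, psi y.1 = g (phi y.1).
  exact: (cvg_fst (F := nbhs z.1) (G := nbhs z.2)) eg.
by apply: filterS eg' => y; rewrite row_mxKl.
Qed.

Lemma snd_hol (M N : complex_manifold) (z : prod_space M N) :
  @hol_map_at (prod_space M N) N snd z.
Proof.
split; first exact: cvg_snd.
move=> V psi cV Vz W chi [U [phi [U' [phi' [cU cU' [-> ->]]]]]] [/= Uz U'z].
have [g [dg eg]] := cm_transition cV Vz cU' U'z.
exists (g \o rsubmx); split => /=.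
  exact: near_differentiable_rsubmx.
have eg' : \forall y \near z, psi y.2 = g (phi' y.2).
  exact: (cvg_snd (F := nbhs z.1) (G := nbhs z.2)) eg.
by apply: filterS eg' => y; rewrite row_mxKr.
Qed.

Definition pr1 (M N : complex_manifold) : hol_map (prod_space M N) M :=
  HolMap (@fst_hol M N).
Definition pr2 (M N : complex_manifold) : hol_map (prod_space M N) N :=
  HolMap (@snd_hol M N).

End Manifolds.

Section LineBundles.
Variable R : realType.
Local Notation C := (cplx R).

(* A holomorphic line bundle is a family of complex lines with a set of local
   frames (U, e), of which only the values of e on U are relevant. *)
Record line_bundle (M : charted_space R) := LineBundle {
  lb_fiber :> M -> vectType C;
  lb_frame : set (set M * (forall x, lb_fiber x));
  lb_dim : forall x, \dim {: lb_fiber x} = 1%N;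
  lb_open : forall U e, lb_frame (U, e) -> open U;
  lb_cover : forall x, exists U e, lb_frame (U, e) /\ U x;
  lb_neq0 : forall U e, lb_frame (U, e) -> forall x, U x -> e x != 0;
  lb_transition : forall U e V e', lb_frame (U, e) -> lb_frame (V, e') ->
    exists f : M -> C, forall x, (U `&` V) x ->
      hol_at f x /\ e x = f x *: e' x }.

Record lb_iso (M : charted_space R) (L L' : line_bundle M) := LbIso {
  lb_map :> forall x, 'Hom(L x, L' x);
  lb_map_bij : forall x, bijective (lb_map x);
  lb_map_hol : forall U e V e', lb_frame (U, e) -> lb_frame (V, e') ->
    exists f : M -> C, forall x, (U `&` V) x ->
      hol_at f x /\ lb_map x (e x) = f x *: e' x }.

Definition lb_isomorphic (M : charted_space R) (L L' : line_bundle M) : Prop :=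
  inhabited (lb_iso L L').

Section TrivialBundle.
Variable M : charted_space R.

Let fiber (x : M) : vectType C := C^o.

Let frame : set (set M * (forall x, fiber x)) := [set (setT, fun=> 1)].

Let trivial_dim x : \dim {: fiber x} = 1%N.
Proof. by rewrite dimvf. Qed.

Let trivial_open U e : frame (U, e) -> open U.
Proof. by case=> -> _; exact: openT. Qed.

Let trivial_cover x : exists U e, frame (U, e) /\ U x.
Proof. by exists setT, (fun=> 1). Qed.

Let trivial_neq0 U e : frame (U, e) -> forall x, U x -> e x != 0.
Proof. by case=> _ -> x _; exact: oner_neq0. Qed.

Let trivial_transition U e V e' : frame (U, e) -> frame (V, e') ->
  exists f : M -> C, forall x, (U `&` V) x -> hol_at f x /\ e x = f x *: e' x.
Proof.
move=> [_ ->] [_ ->]; exists (fun=> 1) => x _.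
by split; [exact: hol_at_cst|rewrite scale1r].
Qed.

Definition trivial_bundle : line_bundle M :=
  @LineBundle M fiber frame trivial_dim trivial_open trivial_cover
    trivial_neq0 trivial_transition.

End TrivialBundle.

Section Pullback.
Variables (M : charted_space R) (N : complex_manifold R) (F : hol_map M N).
Variable L : line_bundle N.

Let fiber (x : M) : vectType C := L (F x).

Let frame : set (set M * (forall x, fiber x)) :=
  [set c | exists U e, lb_frame (U, e) /\ c = (F @^-1` U, fun x => e (F x))].

Let pullback_dim x : \dim {: fiber x} = 1%N.
Proof. exact: lb_dim. Qed.

Let pullback_open U e : frame (U, e) -> open U.
Proof.
move=> [V [e' [fV [-> _]]]].
have /continuousP : continuous F by move=> x; exact: (hol_funP F x).1.
by apply; exact: lb_open fV.
Qed.

Let pullback_cover x : exists U e, frame (U, e) /\ U x.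
Proof.
have [U [e [fU Ux]]] := lb_cover L (F x).
by exists (F @^-1` U), (fun x => e (F x)); split=> //; exists U, e.
Qed.

Let pullback_neq0 U e : frame (U, e) -> forall x, U x -> e x != 0.
Proof. by move=> [V [e' [fV [-> ->]]]] x /= Vx; exact: lb_neq0 fV _ Vx. Qed.

Let pullback_transition U e V e' : frame (U, e) -> frame (V, e') ->
  exists f : M -> C, forall x, (U `&` V) x -> hol_at f x /\ e x = f x *: e' x.
Proof.
move=> [U1 [e1 [fU1 [-> ->]]]] [V1 [e1' [fV1 [-> ->]]]].
have [f hf] := lb_transition fU1 fV1; exists (f \o F) => x /hf[hfx ->].
by split=> //; apply: hol_at_comp hfx; exact: hol_funP.
Qed.

Definition pullback : line_bundle M :=
  @LineBundle M fiber frame pullback_dim pullback_open pullback_cover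
    pullback_neq0 pullback_transition.

End Pullback.

Lemma dim1_scale (V : vectType C) (u v : V) :
  \dim {:V} = 1%N -> u != 0 -> exists c, v = c *: u.
Proof.
move=> V1 u0; apply/vlineP.
suff -> : <[u]>%VS = {:V}%VS by exact: memvf.
by apply/eqP; rewrite eqEdim subvf V1 dim_vline u0.
Qed.

Lemma hom_ext (V W : vectType C) (u : V) (w : W) :
  u != 0 -> exists h : 'Hom(V, W), h u = w.
Proof.
move=> u0; have [f] := linear_of_free [:: u] [:: w].
rewrite seq1_free => /(_ u0 erefl)[fu].
by exists (linfun f); rewrite lfunE.
Qed.

Section HomBundle.
Variables (M : charted_space R) (L L' : line_bundle M).

Let fiber (x : M) : vectType C := 'Hom(L x, L' x).

Let frame : set (set M * (forall x, fiber x)) :=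
  [set c : set M * (forall x, fiber x) | exists U e U' e', [/\ @lb_frame M L (U, e), @lb_frame M L' (U', e'),
    c.1 = U `&` U' & forall x, c.1 x -> c.2 x (e x) = e' x]].

Let hom_dim x : \dim {: fiber x} = 1%N.
Proof.
have -> : \dim {: fiber x} = (\dim {: L x} * \dim {: L' x})%N by rewrite !dimvf.
by rewrite !lb_dim.
Qed.

Let hom_open U h : frame (U, h) -> open U.
Proof.
move=> [V [e [V' [e' [fV fV' /= -> _]]]]].
by apply: openI; [exact: lb_open fV|exact: lb_open fV'].
Qed.

Let hom_cover x : exists U h, frame (U, h) /\ U x.
Proof.
have [U [e [fU Ux]]] := lb_cover L x; have [V [e' [fV Vx]]] := lb_cover L' x.
have H y : exists h : 'Hom(L y, L' y), (U `&` V) y -> h (e y) = e' y.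
  have [Uy|nUy] := pselect (U y); last by exists 0 => -[].
  by have [h he] := hom_ext (e' y) (lb_neq0 fU Uy); exists h.
exists (U `&` V), (fun y => projT1 (cid (H y))); split=> //.
by exists U, e, V, e'; split=> //= y UVy; case: cid => h /=; exact.
Qed.

Let hom_neq0 U h : frame (U, h) -> forall x, U x -> h x != 0.
Proof.
move=> [V [e [V' [e' [fV fV' /= -> he]]]]] x VV'x.
apply: contraNneq (lb_neq0 fV' VV'x.2) => h0.
by rewrite -he // h0 zero_lfunE.
Qed.

Let hom_transition U h V k : frame (U, h) -> frame (V, k) ->
  exists f : M -> C, forall x, (U `&` V) x -> hol_at f x /\ h x = f x *: k x.
Proof.
move=> [U1 [e1 [U1' [e1' [fU1 fU1' /= -> he]]]]].
move=> [V1 [e2 [V1' [e2' [fV1 fV1' /= -> ke]]]]].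
have [a ha] := lb_transition fU1 fV1; have [b hb] := lb_transition fU1' fV1'.
exists (fun x => b x / a x) => x [[Ux U'x] [Vx V'x]].
have [ahol ae] := ha x (conj Ux Vx); have [bhol be] := hb x (conj U'x V'x).
have a0 : a x != 0.
  by apply: contraNneq (lb_neq0 fU1 Ux) => a0; rewrite ae a0 scale0r.
split; first exact: hol_at_div.
apply/lfunP => v.
have [c ->] := dim1_scale v (lb_dim L x) (lb_neq0 fU1 Ux).
rewrite !linearZ /= he //; congr (_ *: _).
by rewrite scale_lfunE ae linearZ /= ke // be scalerA divfK.
Qed.

Definition hom_bundle : line_bundle M :=
  @LineBundle M fiber frame hom_dim hom_open hom_cover hom_neq0 hom_transition.

End HomBundle.

(* For finite-dimensional spaces, L (x) L' = Hom(L^*, L'). *)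
Definition dual_bundle (M : charted_space R) (L : line_bundle M) :=
  hom_bundle L (trivial_bundle M).

Definition tensor_bundle (M : charted_space R) (L L' : line_bundle M) :=
  hom_bundle (dual_bundle L) L'.

Definition tensor_exp (M : charted_space R) (L : line_bundle M) (m : int) :
    line_bundle M :=
  match m with
  | Posz k => iter k (tensor_bundle L) (trivial_bundle M)
  | Negz k => iter k.+1 (tensor_bundle (dual_bundle L)) (trivial_bundle M)
  end.

End LineBundles.

Section ModuliSpaces.
Variables (R : realType) (Q : quiver).
Local Notation C := (cplx R).
Implicit Types (theta : vert Q -> rat) (d : vert Q -> nat).

(* Representations of type d on the spaces V_a = C^(d_a) of column vectors. *)
Definition rep d := forall g : arr Q, 'M[C]_(d (tgt g), d (src g)).

(* The representation space A as a normed space: a representation is the row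
   vector of its matrix entries. *)
Definition rep_entry d := {g : arr Q & 'I_(d (tgt g)) * 'I_(d (src g))}%type.

Definition rep_space d := 'rV[C]_#|{: rep_entry d}|.

Definition rep_of d (v : rep_space d) : rep d := fun g =>
  \matrix_(i, j) v 0 (enum_rank (Tagged _ (i, j) : rep_entry d)).

Definition vec_of d (rho : rep d) : rep_space d :=
  \row_k (let x := enum_val k : rep_entry d in
          rho (tag x) (tagged x).1 (tagged x).2).

Definition subrep d (rho : rep d) (U : forall a, {vspace 'cV[C]_(d a)}) : Prop :=
  forall g (v : 'cV[C]_(d (src g))),
    v \in U (src g) -> rho g *m v \in U (tgt g).

Definition stable theta d (rho : rep d) : Prop :=
  forall U, subrep rho U ->
    (exists a, U a != 0%VS) -> (exists a, U a != fullv) ->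
    slope theta (fun a => \dim (U a)) < slope theta d.

Definition stable_locus theta d : set (rep_space d) :=
  [set v | stable theta (rep_of v)].

Definition stable_space theta d : charted_space R :=
  sub_space (stable_locus theta (d:=d)).

Definition gauge d := forall a : vert Q, 'M[C]_(d a).

Definition in_gauge d (h : gauge d) : Prop := forall a, h a \in unitmx.

Definition in_scalars d (h : gauge d) : Prop :=
  exists2 c : C, c != 0 & forall a, h a = c%:M.

Definition act d (v : rep_space d) (h : gauge d) : rep_space d :=
  vec_of (fun g => invmx (h (tgt g)) *m rep_of v g *m h (src g)).

(* The quotient p : A^s -> N of the stable locus by G / Delta, as the base of a
   holomorphic principal bundle, which determines (N, p) up to a unique
   isomorphism.  Local triviality: for a local section s over U, the map
   (x, [h]) |-> s(x) h from U x (G / Delta) to p^-1(U) is biholomorphic.  A map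
   to G / Delta is holomorphic when it lifts locally to a holomorphic map to G. *)
Record moduli_space theta d := ModuliSpace {
  ms_space :> complex_manifold R;
  ms_proj : hol_map (stable_space theta d) ms_space;
  ms_surj : forall x, exists v, ms_proj v = x;
  ms_orbit : forall v v', ms_proj v = ms_proj v' <->
    exists2 h : gauge d, in_gauge h & set_val v' = act (set_val v) h;
  ms_free : forall (v : stable_space theta d) (h : gauge d), in_gauge h ->
    act (set_val v) h = set_val v -> in_scalars h;
  ms_loc_trivial : forall x : ms_space,
    exists (U : set ms_space) (s : ms_space -> stable_space theta d),
      [/\ open U, U x, forall y, U y -> hol_map_at s y /\ ms_proj (s y) = y &
        forall v, U (ms_proj v) ->
          exists h : stable_space theta d -> gauge d,
            (forall a, hol_at (fun w => h w a) v) /\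
            \forall w \near v,
              in_gauge (h w) /\ set_val w = act (set_val (s (ms_proj w))) (h w)]
}.

(* Num.floor only turns the rational exponents, assumed integral wherever this
   is used, into elements of int. *)
Definition gauge_char theta d (n : int) (h : gauge d) : C :=
  \prod_a \det (h a) ^ Num.floor (n%:~R * (slope theta d - theta a)).

(* F is the line bundle on N whose pull-back to the stable locus is
   equivariantly isomorphic to the trivial bundle with the action
   (v, z) h = (v h, chi(h)^-1 z). *)
Definition is_natural_bundle theta d (n : int) (N : moduli_space theta d)
    (F : line_bundle N) : Prop :=
  exists u : lb_iso (pullback (ms_proj N) F)
                    (trivial_bundle (stable_space theta d)),
    forall (v v' : stable_space theta d) (h : gauge d),
      in_gauge h -> set_val v' = act (set_val v) h ->
      forall (E : ms_proj N v = ms_proj N v') (l : F (ms_proj N v)),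
        u v' (ecast x (F x) E l) = (gauge_char theta n h)^-1 * u v l.

End ModuliSpaces.

Section TensorProduct.
Variables (R : realType) (Q Q' : quiver).
Variables (d : vert Q -> nat) (d' : vert Q' -> nat).
Local Notation C := (cplx R).

(* V_a (x) W_a' is identified with C^(d_a d'_a') by the Kronecker product. *)
Definition tensor_rep (rho : rep R d) (sigma : rep R d') :
    rep R (product_dim d d') :=
  fun g => match g with
           | inl p => 1%:M *t sigma p.2
           | inr p => rho p.1 *t 1%:M
           end.

Definition tensor_vec (v : rep_space R d) (w : rep_space R d') :
    rep_space R (product_dim d d') :=
  vec_of (tensor_rep (rep_of v) (rep_of w)).

(* phi \o (p1 x p2) = p3 \o tensor_vec on the stable loci; the witness t records
   that tensor_vec maps stable pairs to stable representations. *)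
Definition induced_by_tensor theta theta'
    (N1 : moduli_space R theta d) (N2 : moduli_space R theta' d')
    (N3 : moduli_space R (product_weight theta theta') (product_dim d d'))
    (phi : prod_space N1 N2 -> N3) : Prop :=
  forall (v : stable_space R theta d) (w : stable_space R theta' d'),
    exists t : stable_space R (product_weight theta theta') (product_dim d d'),
      set_val t = tensor_vec (set_val v) (set_val w) /\
      phi (ms_proj N1 v, ms_proj N2 w) = ms_proj N3 t.

End TensorProduct.

(* Main.v *)
(* A natural bundle F carries a canonical nonzero vector f(v) in the fibre over
   p(v), the preimage of 1 under p^*F = A^s x C, and f(v h) = chi(h) f(v).
   Composed with local holomorphic sections s1, s2 of p1, p2, these vectors give
   local frames f1(s1)^(n' rk d') (x) f2(s2)^(n rk d) of the tensor bundle and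
   f3(s1 (x) s2) of the pull-back of F3.  Sending one frame to the other does
   not depend on the sections because
     chi3(g (x) g') = chi1(g)^(n' rk d') chi2(g')^(n rk d),
   which follows from det(A (x) B) = det(A)^q det(B)^p and from
   sum_a (mu(d) - theta_a) d_a = 0. *)
Require Import Defs.
From HB Require Import structures.
From mathcomp Require Import all_boot all_order all_algebra.
From mathcomp Require Import perm complex mxtens ring.
From mathcomp Require Import all_classical all_reals all_analysis.

Set Implicit Arguments.
Unset Strict Implicit.
Unset Printing Implicit Defensive.

Import Order.TTheory GRing.Theory Num.Theory.
Import numFieldNormedType.Exports.
Local Open Scope ring_scope.

(** * Determinants and inverses of Kronecker products *)

Section TensorDeterminant.
Context {K : comPzRingType}.

(** The bijection forces [p = q], so [A] arises from [B] by applying one permutation to rows and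
    columns; its sign occurs twice and cancels. *)
Lemma det_reindex {p q : nat} (f : 'I_p -> 'I_q) (A : 'M[K]_p) (B : 'M[K]_q) :
  bijective f -> (forall i j, A i j = B (f i) (f j)) -> \det A = \det B.
Proof.
move=> bf; have pq : p = q by rewrite -[p]card_ord -[q]card_ord (bij_eq_card bf).
subst q => AB; pose s := perm (bij_inj bf).
have -> : A = row_perm s (col_perm s B).
  by apply/matrixP => i j; rewrite !mxE !permE.
by rewrite row_permE col_permE !det_mulmx !det_perm odd_permV mulrCA -signr_addb
  addbb mulr1.
Qed.

(** [mxtens_index (i, j)] is [i * n + j], so splitting off the first [n] indices isolates the block
    [i = 0]; the type ascription is accepted because [m.+1 * n] reduces to [n + m * n]. *)
Lemma tens1mx_block (m n : nat) (B : 'M[K]_n) :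
  (1%:M : 'M[K]_m.+1) *t B = block_mx B 0 0 (1%:M *t B) :> 'M[K]_(n + m * n).
Proof.
have l0 (i : 'I_n) : lshift (m * n) i = mxtens_index (ord0 : 'I_m.+1, i).
  by apply: val_inj; rewrite /= mul0n.
have rS (i : 'I_m) (j : 'I_n) :
    rshift n (mxtens_index (i, j)) = mxtens_index (lift ord0 i, j).
  by apply: val_inj; rewrite /= /bump /= add1n mulSn addnA.
pose T : 'M[K]_(n + m * n) := (1%:M : 'M[K]_m.+1) *t B.
have TE (a a' : 'I_m.+1) (b b' : 'I_n) : T (mxtens_index (a, b)) (mxtens_index (a', b')) =
    (1%:M : 'M[K]_m.+1) a a' * B b b' by exact: tensmxE.
rewrite -/T; apply/matrixP => i j.
case: (split_ordP i) => i0 ->; case: (split_ordP j) => j0 ->.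
- by rewrite block_mxEul !l0 TE mxE eqxx mul1r.
- case: (mxtens_indexP j0) => k l.
  by rewrite block_mxEur l0 rS TE !mxE -val_eqE /= mul0r.
- case: (mxtens_indexP i0) => k l.
  by rewrite block_mxEdl l0 rS TE !mxE -val_eqE /= mul0r.
case: (mxtens_indexP i0) => k l; case: (mxtens_indexP j0) => k' l'.
by rewrite block_mxEdr !rS TE tensmxE !mxE (inj_eq lift_inj).
Qed.

Lemma det_tens1mx (m n : nat) (B : 'M[K]_n) :
  \det ((1%:M : 'M[K]_m) *t B) = \det B ^+ m.
Proof.
elim: m => [|m IH]; first by rewrite expr0; exact: det_mx00.
by rewrite tens1mx_block [LHS]det_ublock IH exprS.
Qed.

Lemma det_tensC (m n : nat) (A : 'M[K]_m) (B : 'M[K]_n) :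
  \det (A *t B) = \det (B *t A).
Proof.
pose f p q (k : 'I_(p * q)) :=
  mxtens_index ((mxtens_unindex k).2, (mxtens_unindex k).1).
apply: (@det_reindex _ _ (f m n)).
  by exists (f n m) => k; case: (mxtens_indexP k) => a b;
    rewrite /f !mxtens_indexK.
move=> i j; case: (mxtens_indexP i) => a b; case: (mxtens_indexP j) => a' b'.
by rewrite /f !mxtens_indexK !tensmxE mulrC.
Qed.

(** [A *t B] factors as [A *t 1%:M] times [1%:M *t B]; [det_tensC] turns the first factor around. *)
Lemma det_tensmx (m n : nat) (A : 'M[K]_m) (B : 'M[K]_n) :
  \det (A *t B) = \det A ^+ n * \det B ^+ m.
Proof. by rewrite tensmx_decr det_mulmx det_tensC !det_tens1mx. Qed.

Lemma tens1mx1 (m n : nat) : 1%:M *t 1%:M = 1%:M :> 'M[K]_(m * n).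
Proof.
apply/matrixP => i j.
case: (mxtens_indexP i) => a b; case: (mxtens_indexP j) => a' b'.
rewrite tensmxE !mxE -natrM mulnb.
by rewrite (can_eq (@mxtens_indexK _ _)) xpair_eqE.
Qed.

End TensorDeterminant.

Section TensorInverse.
Context {K : comUnitRingType} {m n : nat}.
Variables (A : 'M[K]_m) (B : 'M[K]_n).
Hypotheses (uA : A \in unitmx) (uB : B \in unitmx).

Let tensVK : (invmx A *t invmx B) *m (A *t B) = 1%:M.
Proof. by rewrite tensmx_mul !mulVmx // tens1mx1. Qed.

Lemma unitmx_tens : A *t B \in unitmx.
Proof. by case: (mulmx1_unit tensVK). Qed.

Lemma invmx_tens : invmx (A *t B) = invmx A *t invmx B.
Proof.
by rewrite -[LHS]mul1mx -tensVK mulmxK // unitmx_tens.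
Qed.

End TensorInverse.

Lemma prod_exprz (F : fieldType) (I : finType) (x : F) (f : I -> int) :
  x != 0 -> \prod_i x ^ f i = x ^ (\sum_i f i).
Proof.
by move=> x0; rewrite (big_morph (exprz x) (fun m n => expfzDr m n x0) (expr0z x)).
Qed.

Lemma prod_expz (F : fieldType) (I : finType) (f : I -> F) (m : int) :
  (\prod_i f i) ^ m = \prod_i f i ^ m.
Proof.
exact: (big_morph (fun x => x ^ m) (fun x y => expfzMl x y m) (exp1rz _ m)).
Qed.

(** * Ranks and slopes, and their behaviour under products *)

Section Slopes.
Context {Q : quiver}.
Variables (theta : vert Q -> rat) (d : vert Q -> nat).
Hypothesis d_gt0 : forall a, (0 < d a)%N.

Lemma rk_gt0 : (0 < rk d)%N.
Proof.
have /card_gt0P[a _] := vert_gt0 Q.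
by rewrite /rk (bigD1 a) //= ltn_addr.
Qed.

Lemma rkZ : (rk d)%:Z = \sum_a (d a)%:Z.
Proof. by rewrite -natz natr_sum; apply: eq_bigr => a _; rewrite natz. Qed.

(** The slope is the mean of [theta] weighted by [d], so the weighted deviations cancel. *)
Lemma slope_defect : \sum_a (slope theta d - theta a) * (d a)%:R = 0.
Proof.
under eq_bigr do rewrite mulrBl.
rewrite sumrB -mulr_sumr -natr_sum /slope divfK ?subrr //.
by rewrite pnatr_eq0 -lt0n rk_gt0.
Qed.

End Slopes.

Section ProductSlope.
Context {Q Q' : quiver}.
Variables (theta : vert Q -> rat) (theta' : vert Q' -> rat).
Variables (d : vert Q -> nat) (d' : vert Q' -> nat).
Hypothesis d_gt0 : forall a, (0 < d a)%N.
Hypothesis d'_gt0 : forall a, (0 < d' a)%N.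

Lemma rk_product : rk (product_dim d d') = (rk d * rk d')%N.
Proof.
rewrite /rk big_distrl /=; under [RHS]eq_bigr do rewrite big_distrr /=.
by rewrite pair_bigA.
Qed.

Lemma slope_product :
  slope (product_weight theta theta') (product_dim d d') =
  slope theta d + slope theta' d'.
Proof.
have r0 : (rk d)%:R != 0 :> rat by rewrite pnatr_eq0 -lt0n rk_gt0.
have r0' : (rk d')%:R != 0 :> rat by rewrite pnatr_eq0 -lt0n rk_gt0.
rewrite /slope rk_product natrM.
(* The weight is additive, so the sum splits, and each summand picks up the rank of the other
   factor. *)
have -> : \sum_a product_weight theta theta' a * (product_dim d d' a)%:R =
    (\sum_a theta a * (d a)%:R) * (rk d')%:R +
    (\sum_a theta' a * (d' a)%:R) * (rk d)%:R :> rat.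
  rewrite /rk !natr_sum [X in _ = _ + X]mulrC !big_distrl /= -big_split /=.
  under [RHS]eq_bigr do rewrite !big_distrr /= -big_split /=.
  rewrite pair_bigA /=; apply: eq_bigr => -[a b] _.
  by rewrite /product_weight /product_dim /= natrM; ring.
by field; rewrite r0 r0'.
Qed.

End ProductSlope.

(** * Tensor products of gauge transformations and the character identity *)

Section TensorGauge.
Context {R : realType} {Q Q' : quiver}.
Context {d : vert Q -> nat} {d' : vert Q' -> nat}.

Definition tensor_gauge (h : gauge R d) (h' : gauge R d') :
  gauge R (product_dim d d') := fun p => h p.1 *t h' p.2.

Lemma tensor_in_gauge (h : gauge R d) (h' : gauge R d') :
  in_gauge h -> in_gauge h' -> in_gauge (tensor_gauge h h').
Proof. by move=> hh hh' p; exact: unitmx_tens. Qed.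

Lemma vec_ofK (Q0 : quiver) (d0 : vert Q0 -> nat) (rho : rep R d0) g :
  rep_of (vec_of rho) g = rho g.
Proof. by apply/matrixP => i j; rewrite !mxE enum_rankK. Qed.

(** By the mixed product rule: on each arrow one tensor factor is an identity, which conjugation
    fixes, and the other transforms as in its own quiver. *)
Lemma tensor_vec_act (v : rep_space R d) (w : rep_space R d')
    (h : gauge R d) (h' : gauge R d') :
  in_gauge h -> in_gauge h' ->
  tensor_vec (act v h) (act w h') = act (tensor_vec v w) (tensor_gauge h h').
Proof.
move=> hh hh'; congr vec_of; apply: functional_extensionality_dep => g.
rewrite vec_ofK /tensor_gauge.
case: g => -[a b] /=.
  by rewrite vec_ofK invmx_tens // !tensmx_mul mulmx1 mulVmx.
by rewrite vec_ofK invmx_tens // !tensmx_mul mulmx1 mulVmx.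
Qed.

Lemma gauge_char_neq0 (Q0 : quiver) (t0 : vert Q0 -> rat) (d0 : vert Q0 -> nat)
  (n : int) (h : gauge R d0) : in_gauge h -> gauge_char t0 n h != 0.
Proof.
move=> hh; apply/prodf_neq0 => a _; rewrite expfz_eq0 negb_and; apply/orP; right.
by rewrite -unitfE -unitmxE.
Qed.

Section Character.
Variables (theta : vert Q -> rat) (theta' : vert Q' -> rat) (n n' : int).
Hypothesis d_gt0 : forall a, (0 < d a)%N.
Hypothesis d'_gt0 : forall a, (0 < d' a)%N.
Hypothesis n_int : forall a, n%:~R * (slope theta d - theta a) \is a Num.int.
Hypothesis n'_int :
  forall a, n'%:~R * (slope theta' d' - theta' a) \is a Num.int.

(** Integrality makes the floors exact, so in [rat] the sum is [m] times the one in
    [slope_defect]. *)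
Lemma sum_exponents (Q0 : quiver) (t0 : vert Q0 -> rat) (d0 : vert Q0 -> nat)
    (m : int) :
  (forall a, (0 < d0 a)%N) ->
  (forall a, m%:~R * (slope t0 d0 - t0 a) \is a Num.int) ->
  \sum_a Num.floor (m%:~R * (slope t0 d0 - t0 a)) * (d0 a)%:Z = 0.
Proof.
move=> d0_gt0 m_int; apply: (@intr_inj rat).
transitivity (m%:~R * \sum_a (slope t0 d0 - t0 a) * (d0 a)%:R).
  rewrite rmorph_sum mulr_sumr; apply: eq_bigr => a _.
  by rewrite /= intrM floorK // mulrA.
by rewrite slope_defect // mulr0.
Qed.

(** At [(a, b)], [det_tensmx] gives [\det (h a)] the multiplicity [d' b]. In the total exponent of
    [\det (h a)] the terms in [E' b] sum to 0 by [sum_exponents] and the others to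
    [n' * E a * rk d']; symmetrically for [h']. *)
Lemma gauge_char_tensor (h : gauge R d) (h' : gauge R d') :
  in_gauge h -> in_gauge h' ->
  gauge_char (product_weight theta theta') (n * n') (tensor_gauge h h') =
  gauge_char theta n h ^ (n' * (rk d')%:Z) *
  gauge_char theta' n' h' ^ (n * (rk d)%:Z).
Proof.
move=> hh hh'.
have h0 a : \det (h a) != 0 by rewrite -unitfE -unitmxE.
have h'0 a : \det (h' a) != 0 by rewrite -unitfE -unitmxE.
pose E a := Num.floor (n%:~R * (slope theta d - theta a)).
pose E' a := Num.floor (n'%:~R * (slope theta' d' - theta' a)).
have floorE a b : Num.floor ((n * n')%:~R *
    (slope (product_weight theta theta') (product_dim d d') -
     product_weight theta theta' (a, b))) = n' * E a + n * E' b.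
  (* The right side, being an integer, is the floor of its image in [rat]; the arguments agree
     because slopes add. *)
  rewrite -[RHS](@intrKfloor rat) intrD !intrM !floorK // slope_product //.
  by congr Num.floor; rewrite /product_weight /=; ring.
transitivity (\prod_a \prod_b
    (\det (h a) ^ ((d' b)%:Z * (n' * E a + n * E' b)) *
     \det (h' b) ^ ((d a)%:Z * (n' * E a + n * E' b)))).
  rewrite pair_bigA; apply: eq_bigr => -[a b] _ /=.
  by rewrite floorE det_tensmx expfzMl !exprnP !exprz_exp.
under eq_bigr do rewrite big_split /=.
rewrite big_split /=; congr (_ * _).
  rewrite prod_expz; apply: eq_bigr => a _.
  rewrite prod_exprz // exprz_exp; congr (_ ^ _).
  transitivity (n' * E a * (\sum_b (d' b)%:Z) + n * (\sum_b E' b * (d' b)%:Z)).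
    by rewrite !mulr_sumr -big_split /=; apply: eq_bigr => b _; ring.
  by rewrite -rkZ sum_exponents // -/(E a); ring.
rewrite exchange_big prod_expz; apply: eq_bigr => b _.
rewrite prod_exprz // exprz_exp; congr (_ ^ _).
transitivity (n * E' b * (\sum_a (d a)%:Z) + n' * (\sum_a E a * (d a)%:Z)).
  by rewrite !mulr_sumr -big_split /=; apply: eq_bigr => a _; ring.
by rewrite -rkZ sum_exponents // -/(E' b); ring.
Qed.

End Character.
End TensorGauge.

(** * Holomorphic maps between charted spaces *)

Section Holomorphy.
Local Open Scope classical_set_scope.
Context {R : realType}.
Local Notation C := (cplx R).

Lemma near_eq_hol_at (M : charted_space R) (E : normedModType C) (f g : M -> E)
    (x : M) :
  (\forall y \near x, f y = g y) -> hol_at f x -> hol_at g x.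
Proof.
move=> fg hf U phi cU Ux; have [k [dk ek]] := hf U phi cU Ux.
exists k; split=> //; near=> y.
by rewrite -(near fg y) // (near ek y).
Unshelve. all: by end_near. Qed.

Lemma near_eq_hol_map_at (M N : charted_space R) (f g : M -> N) (x : M) :
  (\forall y \near x, f y = g y) -> hol_map_at f x -> hol_map_at g x.
Proof.
move=> fg [cf hf]; have fgx : f x = g x := nbhs_singleton fg.
split.
  rewrite /prop_for /continuous_at -fgx; apply: cvg_trans cf.
  by apply: near_eq_cvg; near=> y; rewrite (near fg y).
move=> V psi cV; rewrite -fgx => /(hf _ _ cV).
by apply: near_eq_hol_at; near=> y; rewrite /= (near fg y).
Unshelve. all: by end_near. Qed.

Lemma hol_at_inv (M : charted_space R) (f : M -> C) (x : M) :
  hol_at f x -> f x != 0 -> hol_at (fun y => (f y)^-1) x.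
Proof.
move=> hf f0; have := hol_at_div (@hol_at_cst R M C 1 x) hf f0.
by apply: near_eq_hol_at; near=> y; rewrite div1r.
Unshelve. all: by end_near. Qed.

(** Variant of [hol_at_comp] whose middle space is a charted space with a chart at [F x], such as a
    stable locus. *)
Lemma hol_map_at_comp (M N : charted_space R) (E : normedModType C)
    (F : M -> N) (f : N -> E) (x : M) :
  (exists U phi, @cs_chart R N (U, phi) /\ U (F x)) ->
  hol_map_at F x -> hol_at f (F x) -> hol_at (f \o F) x.
Proof.
move=> [V [psi [cV Vx]]] [Fc Fh] hf U phi cU Ux.
have [G [dG eG]] := Fh V psi cV Vx U phi cU Ux.
have [g [dg eg]] := hf V psi cV Vx.
have Gc : {for phi x, continuous G}.
  by apply: differentiable_continuous; exact: nbhs_singleton dG.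
have GE : G (phi x) = psi (F x) by rewrite -(nbhs_singleton eG).
exists (g \o G); split.
  have dg' : \forall v \near phi x, differentiable g (G v).
    by apply: (Gc (fun w => differentiable g w)); rewrite GE.
  near=> v; apply: differentiable_comp; near: v; [exact: dG|exact: dg'].
have eg' : \forall y \near x, f (F y) = g (psi (F y)).
  exact: (Fc (fun z => f z = g (psi z))).
near=> y; rewrite /= (near eg' y _) //.
by have /= -> // := near eG y _.
Unshelve. all: by end_near. Qed.

(** Such a map is a finite sum of coordinate functions times constant vectors. *)
Lemma differentiable_rV_linear n (E : normedModType C)
    (f : {linear 'rV[C]_n -> E}) (v : 'rV[C]_n) : differentiable f v.
Proof.
have -> : (f : 'rV[C]_n -> E) =
    \sum_(i < n) (fun v : 'rV[C]_n => v ord0 i *: f (delta_mx 0 i)).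
  apply/funext => w; rewrite fct_sumE {1}[w]row_sum_delta linear_sum.
  by apply: eq_bigr => i _; rewrite linearZ.
apply: differentiable_sum => i; apply: differentiableZl.
exact: differentiable_coord.
Qed.

Lemma hol_at_linear n (M : charted_space R) (E : normedModType C)
    (f : {linear 'rV[C]_n -> E}) (g : M -> 'rV[C]_n) (x : M) :
  hol_at g x -> hol_at (f \o g) x.
Proof.
move=> hg U phi cU Ux; have [k [dk ek]] := hg U phi cU Ux.
exists (f \o k); split; last by apply: filterS ek => y /= ->.
apply: filterS dk => v dkv; apply: differentiable_comp => //.
exact: differentiable_rV_linear.
Qed.

Lemma hol_at_add (M : charted_space R) (E : normedModType C) (f g : M -> E)
    (x : M) :
  hol_at f x -> hol_at g x -> hol_at (fun y => f y + g y) x.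
Proof.
move=> hf hg U phi cU Ux.
have [f1 [df ef]] := hf U phi cU Ux; have [g1 [dg eg]] := hg U phi cU Ux.
exists (f1 + g1); split.
  by near=> v; apply: differentiableD; near: v.
by near=> y; rewrite (near ef y _) ?(near eg y _).
Unshelve. all: by end_near. Qed.

(** The subset carries the topology induced by [set_val], so every neighbourhood contains the
    preimage of an open [W']. *)
Lemma continuous_set_val (T : topologicalType) (S : topologicalType) (A : set T)
    (f : S -> A) (x : S) :
  {for x, continuous (fun y => set_val (f y) : T)} -> {for x, continuous f}.
Proof.
move=> cf V [/= W [[W' oW' <-]] /= W'fx WV].
apply: (filterS (P := fun y => W' (set_val (f y)))) => [y W'y|]; first exact: WV.
by apply: cf; exact: open_nbhs_nbhs.
Qed.

(** The inclusion is the only chart of [sub_space A], so holomorphy into it is tested in the ambient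
    space. *)
Lemma hol_map_sub_space n (A : set 'rV[C]_n) (M : charted_space R)
    (f : M -> sub_space A) (x : M) :
  {for x, continuous (fun y => set_val (f y) : 'rV[C]_n)} ->
  hol_at (fun y => set_val (f y) : 'rV[C]_n) x -> hol_map_at f x.
Proof.
move=> cf hf; split; last by move=> V psi [-> ->] _.
exact: continuous_set_val.
Qed.

Lemma hol_map_comp (M N P : charted_space R) (F : M -> N) (G : N -> P) (x : M) :
  (exists U phi, @cs_chart R N (U, phi) /\ U (F x)) ->
  hol_map_at F x -> hol_map_at G (F x) -> hol_map_at (G \o F) x.
Proof.
move=> NF hF [cG hG]; split; first by apply: continuous_comp => //; exact: hF.1.
move=> V psi cV VGF.
exact: (@hol_map_at_comp M N _ F (psi \o G) x NF hF (hG _ _ cV VGF)).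
Qed.

Lemma hol_at_set_val n (A : set 'rV[C]_n) (M : charted_space R)
    (f : M -> sub_space A) (x : M) :
  hol_map_at f x -> hol_at (fun y => set_val (f y) : 'rV[C]_n) x.
Proof. by case=> _ h; exact: (h setT set_val). Qed.

End Holomorphy.

(** * Vectors in the fibres of dual, tensor and power bundles *)

Section FrameVectors.
Local Open Scope classical_set_scope.
Context {R : realType} {M : charted_space R}.
Local Notation C := (cplx R).
Implicit Types L : line_bundle M.

Lemma hom_dim1_ext (V W : vectType C) (u : V) (h k : 'Hom(V, W)) :
  \dim {:V} = 1%N -> u != 0 -> h u = k u -> h = k.
Proof.
move=> V1 u0 hk; apply/lfunP => v.
by have [c ->] := dim1_scale v V1 u0; rewrite !linearZ /= hk.
Qed.

(* Junk value when e = 0. *)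
Definition hom_vec L L' x (e : L x) (e' : L' x) : hom_bundle L L' x :=
  xget 0 [set h : 'Hom(L x, L' x) | h e = e'].

Lemma hom_vecE L L' x (e : L x) (e' : L' x) :
  e != 0 -> (hom_vec e e' : 'Hom(L x, L' x)) e = e'.
Proof.
move=> e0; have [h he] := hom_ext e' e0.
by apply: (@xgetPex _ 0 [set h : 'Hom(L x, L' x) | h e = e']); exists h.
Qed.

Lemma hom_vec_neq0 L L' x (e : L x) (e' : L' x) :
  e != 0 -> e' != 0 -> hom_vec e e' != 0.
Proof.
move=> e0; apply: contraNneq => h0; rewrite -(hom_vecE e' e0).
by rewrite h0 zero_lfunE.
Qed.

Lemma hom_vecZ L L' x (e : L x) (e' : L' x) (c c' : C) :
  c != 0 -> e != 0 -> hom_vec (c *: e) (c' *: e') = (c' / c) *: hom_vec e e'.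
Proof.
move=> c0 e0; have ce0 : c *: e != 0 by rewrite scaler_eq0 negb_or c0.
apply: (@hom_dim1_ext (L x) (L' x) (c *: e)) => //; first exact: lb_dim.
rewrite hom_vecE // scale_lfunE linearZ /= hom_vecE //.
by rewrite scalerA divfK.
Qed.

Definition dual_vec L x (e : L x) : dual_bundle L x :=
  hom_vec e (1 : trivial_bundle M x).

(** Since [tensor_bundle] is Hom out of the dual, the pure tensor of a nonzero [e] with [e'] is the
    map taking the dual vector of [e] to [e']. *)
Definition tens_vec L L' x (e : L x) (e' : L' x) : tensor_bundle L L' x :=
  hom_vec (dual_vec e) e'.

Fixpoint expn_vec L k x (e : L x) :
    iter k (tensor_bundle L) (trivial_bundle M) x :=
  match k with
  | 0 => (1 : trivial_bundle M x)
  | k'.+1 => tens_vec e (expn_vec k' e)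
  end.

(** [Negz k] stands for [-(k+1)], whence the [k.+1] factors of the dual vector. *)
Definition exp_vec L m x (e : L x) : tensor_exp L m x :=
  match m with
  | Posz k => expn_vec k e
  | Negz k => expn_vec k.+1 (dual_vec e)
  end.

Lemma dual_vec_neq0 L x (e : L x) : e != 0 -> dual_vec e != 0.
Proof. by move=> e0; apply: hom_vec_neq0 => //; exact: oner_neq0. Qed.

Lemma dual_vecZ L x (e : L x) (c : C) :
  c != 0 -> e != 0 -> dual_vec (c *: e) = c^-1 *: dual_vec e.
Proof.
move=> c0 e0; rewrite /dual_vec -[in LHS](scale1r (1 : trivial_bundle M x)).
by rewrite hom_vecZ // div1r.
Qed.

Lemma tens_vec_neq0 L L' x (e : L x) (e' : L' x) :
  e != 0 -> e' != 0 -> tens_vec e e' != 0.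
Proof. by move=> e0 e'0; apply: hom_vec_neq0 => //; exact: dual_vec_neq0. Qed.

(** The dual vector scales by [c^-1], and Hom inverts the scaling of its source once more. *)
Lemma tens_vecZ L L' x (e : L x) (e' : L' x) (c c' : C) :
  c != 0 -> e != 0 -> tens_vec (c *: e) (c' *: e') = (c * c') *: tens_vec e e'.
Proof.
move=> c0 e0; rewrite /tens_vec dual_vecZ // hom_vecZ ?invr_eq0 //.
  by rewrite invrK mulrC.
exact: dual_vec_neq0.
Qed.

Lemma expn_vecZ L k x (e : L x) (c : C) :
  c != 0 -> e != 0 -> expn_vec k (c *: e) = c ^+ k *: expn_vec k e.
Proof.
move=> c0 e0; elim: k => [|k IH] /=; first by rewrite expr0 scale1r.
by rewrite IH tens_vecZ // exprS.
Qed.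

Lemma expn_vec_neq0 L k x (e : L x) : e != 0 -> expn_vec k e != 0.
Proof.
move=> e0; elim: k => [|k IH]; first exact: oner_neq0.
exact: tens_vec_neq0.
Qed.

Lemma exp_vec_neq0 L m x (e : L x) : e != 0 -> exp_vec m e != 0.
Proof.
by move=> e0; case: m => k; apply: expn_vec_neq0 => //; exact: dual_vec_neq0.
Qed.

Lemma exp_vecZ L m x (e : L x) (c : C) :
  c != 0 -> e != 0 -> exp_vec m (c *: e) = c ^ m *: exp_vec m e.
Proof.
move=> c0 e0; case: m => k; first exact: expn_vecZ.
rewrite /exp_vec dual_vecZ // expn_vecZ ?invr_eq0 ?dual_vec_neq0 //.
by rewrite exprVn.
Qed.

End FrameVectors.

(** * Holomorphic frames and isomorphisms glued from them *)

Section HolomorphicFrames.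
Local Open Scope classical_set_scope.
Context {R : realType}.
Local Notation C := (cplx R).

(* A holomorphic frame over U of the pull-back of L along F.  Stating this for
   a mere function F avoids comparing pull-backs of powers with powers of
   pull-backs. *)
Definition hol_frame (M N : charted_space R) (F : M -> N) (L : line_bundle N)
    (U : set M) (e : forall x, L (F x)) : Prop :=
  forall V e', @lb_frame R N L (V, e') ->
    exists f : M -> C, forall x, U x -> V (F x) ->
      [/\ hol_at f x, f x != 0 & e x = f x *: e' (F x)].

Section Operations.
Context {M N : charted_space R}.
Variables (F : M -> N) (U : set M).
Implicit Types L : line_bundle N.

Lemma hol_frame_neq0 L (e : forall x, L (F x)) x :
  hol_frame U e -> U x -> e x != 0.
Proof.
move=> he Ux; have [V [e' [fV Vx]]] := lb_cover L (F x).
have [f hf] := he V e' fV; have [_ fx0 ->] := hf x Ux Vx.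
by rewrite scaler_eq0 negb_or fx0 (lb_neq0 fV Vx).
Qed.

(** With [e = a e1] and [e' = b e2], the map sending [e] to [e'] is [b / a] times the one sending
    [e1] to [e2]; evaluation at [e x] decides this because the fibres are lines. *)
Lemma hol_frame_hom L L' (e : forall x, L (F x)) (e' : forall x, L' (F x)) :
  hol_frame U e -> hol_frame U e' ->
  hol_frame (L := hom_bundle L L') U (fun x => hom_vec (e x) (e' x)).
Proof.
move=> he he' V h [V1 [e1 [V2 [e2 [f1 f2 /= -> hE]]]]].
have [a ha] := he _ _ f1; have [b hb] := he' _ _ f2.
exists (fun x => b x / a x) => x Ux [V1x V2x].
have [ahol a0 ae] := ha x Ux V1x; have [bhol b0 be] := hb x Ux V2x.
split; [exact: hol_at_div | by rewrite mulf_neq0 ?invr_eq0 |].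
have ex0 := hol_frame_neq0 he Ux.
apply: (@hom_dim1_ext _ (L (F x)) (L' (F x)) (e x)) => //; first exact: lb_dim.
rewrite hom_vecE // scale_lfunE be ae linearZ /= hE //.
by rewrite scalerA divfK.
Qed.

Lemma hol_frame_trivial :
  hol_frame (F := F) (L := trivial_bundle N) U (fun=> 1).
Proof.
move=> V e' [_ ->]; exists (fun=> 1) => x _ _.
by split; [exact: hol_at_cst | exact: oner_neq0 | rewrite scale1r].
Qed.

Lemma hol_frame_dual L (e : forall x, L (F x)) :
  hol_frame U e -> hol_frame (L := dual_bundle L) U (fun x => dual_vec (e x)).
Proof. by move=> he; apply: hol_frame_hom => //; exact: hol_frame_trivial. Qed.

Lemma hol_frame_tens L L' (e : forall x, L (F x)) (e' : forall x, L' (F x)) :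
  hol_frame U e -> hol_frame U e' ->
  hol_frame (L := tensor_bundle L L') U (fun x => tens_vec (e x) (e' x)).
Proof.
by move=> he he'; apply: hol_frame_hom => //; exact: hol_frame_dual.
Qed.

Lemma hol_frame_expn L k (e : forall x, L (F x)) :
  hol_frame U e ->
  hol_frame (L := iter k (tensor_bundle L) (trivial_bundle N)) U
    (fun x => expn_vec k (e x)).
Proof.
move=> he; elim: k => [|k IH]; first exact: hol_frame_trivial.
exact: hol_frame_tens.
Qed.

Lemma hol_frame_exp L m (e : forall x, L (F x)) :
  hol_frame U e ->
  hol_frame (L := tensor_exp L m) U (fun x => exp_vec m (e x)).
Proof.
move=> he; case: m => k; first exact: hol_frame_expn.
by apply: hol_frame_expn; exact: hol_frame_dual.
Qed.

End Operations.

(** Frames of [pullback F L] are those of [L] composed with [F], so the same coefficients serve;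
    [F := id] expresses frames of a bundle on [M] itself. *)
Lemma hol_frame_pullback (M : charted_space R) (N : complex_manifold R)
    (F : hol_map M N) (L : line_bundle N) (U : set M) (e : forall x, L (F x)) :
  hol_frame U e -> hol_frame (F := id) (L := pullback F L) U e.
Proof.
move=> he V e' [V1 [e1 [f1 [-> ->]]]].
by have [f hf] := he _ _ f1; exists f => x; exact: hf.
Qed.

(** The isomorphism sends [e i x] to [e' i x]; this is independent of [i] because both frames change
    by the same scalar. *)
Lemma iso_of_frames (M : charted_space R) (L L' : line_bundle M) (I : Type)
    (U : I -> set M) (e : I -> forall x, L x) (e' : I -> forall x, L' x) :
  (forall x : M, exists i, \forall y \near x, U i y) ->
  (forall i, hol_frame (F := id) (U i) (e i)) ->
  (forall i, hol_frame (F := id) (U i) (e' i)) ->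
  (forall i j x, U i x -> U j x ->
    exists c : C, e j x = c *: e i x /\ e' j x = c *: e' i x) ->
  lb_isomorphic L L'.
Proof.
move=> cover he he' compat.
have e0 i x : U i x -> e i x != 0 by exact: (hol_frame_neq0 (he i)).
have e'0 i x : U i x -> e' i x != 0 by exact: (hol_frame_neq0 (he' i)).
have /= exh x : exists h : 'Hom(L x, L' x), forall i, U i x -> h (e i x) = e' i x.
  have [i /nbhs_singleton Uix] := cover x.
  have [h hE] := hom_ext (e' i x) (e0 i x Uix); exists h => j Ujx.
  by have [c [-> ->]] := compat i j x Uix Ujx; rewrite linearZ /= hE.
pose h x := projT1 (cid (exh x)).
have hE i x : U i x -> h x (e i x) = e' i x by exact: (projT2 (cid (exh x))).
have hbij x : bijective (h x).
  have [i /nbhs_singleton Uix] := cover x.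
  have [k kE] := hom_ext (e i x) (e'0 i x Uix).
  exists k => v.
    have [c ->] := dim1_scale v (lb_dim L x) (e0 i x Uix).
    by rewrite !linearZ /= hE // kE.
  have [c ->] := dim1_scale v (lb_dim L' x) (e'0 i x Uix).
  by rewrite !linearZ /= kE hE.
have hhol V a V' a' : lb_frame (V, a) -> lb_frame (V', a') ->
    exists f : M -> C, forall x, (V `&` V') x ->
      hol_at f x /\ h x (a x) = f x *: a' x.
  move=> fV fV'.
  (* The coefficient is picked pointwise, with 0 outside the overlap; its holomorphy is shown
     afterwards. *)
  have exf x : exists c : C, (V `&` V') x -> h x (a x) = c *: a' x.
    have [VV'x|nVV'] := pselect ((V `&` V') x); last by exists 0.
    have [c ->] := dim1_scale (h x (a x)) (lb_dim L' x) (lb_neq0 fV' VV'x.2).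
    by exists c.
  exists (fun x => projT1 (cid (exf x))) => x VV'x.
  split; last exact: (projT2 (cid (exf x))).
  have [i Ui] := cover x.
  have [p hp] := he i _ _ fV; have [q hq] := he' i _ _ fV'.
  have [phol p0 _] := hp x (nbhs_singleton Ui) VV'x.1.
  have [qhol _ _] := hq x (nbhs_singleton Ui) VV'x.2.
  (* Near [x] the coefficient is [q / p], where [e i = p a] and [e' i = q a']. *)
  apply: near_eq_hol_at (hol_at_div qhol phol p0).
  have nV : \forall y \near x, (V `&` V') y.
    by apply: open_nbhs_nbhs; split=> //; apply: openI;
      [exact: lb_open fV | exact: lb_open fV'].
  near=> y.
  have Uiy : U i y by near: y.
  have VV'y : (V `&` V') y by near: y.
  case: cid => c /= /(_ VV'y) hc.
  have [_ py pe] := hp y Uiy VV'y.1; have [_ _ qe] := hq y Uiy VV'y.2.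
  have := hE i y Uiy; rewrite pe qe linearZ /= hc scalerA => /eqP.
  rewrite -subr_eq0 -scalerBl scaler_eq0 (negPf (lb_neq0 fV' VV'y.2)) orbF.
  by rewrite subr_eq0 => /eqP <-; rewrite mulrAC mulfV // mul1r.
by constructor; exact: (@LbIso _ _ _ _ h hbij hhol).
Unshelve. all: by end_near. Qed.

End HolomorphicFrames.

(** * Frames of a natural bundle from sections of the quotient map *)

Section NaturalFrames.
Local Open Scope classical_set_scope.
Context {R : realType} {Q : quiver} {theta : vert Q -> rat}.
Context {d : vert Q -> nat}.
Variable N : moduli_space R theta d.

Lemma stable_chart (v : stable_space R theta d) :
  exists U phi, @cs_chart R (stable_space R theta d) (U, phi) /\ U v.
Proof. by exists setT, set_val. Qed.

(** Surjectivity of the projection extends a local section to a set-theoretic one on all of [N]; the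
    fibre equation then holds at every point, and frames built from the section are total
    functions. *)
Lemma moduli_section (x : N) :
  exists2 s : N -> stable_space R theta d, forall y, ms_proj N (s y) = y &
    \forall y \near x, hol_map_at s y.
Proof.
have [U [s [oU Ux sU _]]] := ms_loc_trivial x.
pose s' y := if pselect (U y) then s y else projT1 (cid (ms_surj y)).
exists s'.
  move=> y; rewrite /s'; case: pselect => [Uy|nUy]; first exact: (sU y Uy).2.
  exact: (projT2 (cid (ms_surj y))).
have nU y : U y -> \forall z \near y, U z.
  by move=> Uy; exact: open_nbhs_nbhs.
apply: filterS (nU x Ux) => y Uy.
apply: near_eq_hol_map_at (sU y Uy).1.
by apply: filterS (nU y Uy) => z Uz; rewrite /s'; case: pselect.
Qed.

Variable F : line_bundle N.
Variable u : lb_iso (pullback (ms_proj N) F)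
                    (trivial_bundle (stable_space R theta d)).

(** The default 0 is never taken, because [u v] is surjective. *)
Definition nat_vec (v : stable_space R theta d) : F (ms_proj N v) :=
  xget 0 [set l : F (ms_proj N v) | u v l = 1 :> cplx R].

Lemma nat_vecE v : u v (nat_vec v) = 1 :> cplx R.
Proof.
have [g _ gK] := lb_map_bij u v.
apply: (@xgetPex _ 0 [set l : F (ms_proj N v) | u v l = 1 :> cplx R]).
by exists (g 1); exact: gK.
Qed.

(** Transport along [E] brings vectors from different points of one orbit into the same fibre [F x],
    where they can be compared. *)
Definition nat_frame (v : stable_space R theta d) (x : N)
    (E : ms_proj N v = x) : F x := ecast y (F y) E (nat_vec v).

Lemma nat_frame_neq0 v x (E : ms_proj N v = x) : nat_frame E != 0.
Proof.
case: x / E; rewrite /nat_frame /=; have := nat_vecE v.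
by apply: contra_eqN => /eqP ->; rewrite linear0 eq_sym oner_eq0.
Qed.

(** [u] takes a pulled-back frame [e'] of [F] to a holomorphic function [f], without zeros by
    injectivity. The canonical vector is thus [f^-1 e'], and composing [f] with [s] gives the
    coefficient. *)
Lemma hol_frame_nat (M : charted_space R) (G : M -> N)
    (s : M -> stable_space R theta d) (E : forall x, ms_proj N (s x) = G x)
    (U : set M) :
  (forall x, U x -> hol_map_at s x) ->
  hol_frame (L := F) U (fun x => nat_frame (E x)).
Proof.
move=> hs V e' fV.
have fpV : lb_frame (l := pullback (ms_proj N) F)
    (ms_proj N @^-1` V, fun v => e' (ms_proj N v)) by exists V, e'.
have [f hf] := lb_map_hol u fpV (erefl : lb_frame (l := trivial_bundle _) _).
have f0 v : V (ms_proj N v) -> f v != 0.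
  move=> Vv; have [_ uf] := hf v (conj Vv I).
  apply: contraNneq (lb_neq0 fV Vv) => fv0; apply/eqP.
  have [g gK _] := lb_map_bij u v.
  apply: (can_inj gK); rewrite linear0 uf fv0; exact: scale0r.
have natE v x (Ev : ms_proj N v = x) : V x -> nat_frame Ev = (f v)^-1 *: e' x.
  case: x / Ev => Vv; have [_ uf] := hf v (conj Vv I).
  have [g gK _] := lb_map_bij u v.
  apply: (can_inj gK); rewrite linearZ /= nat_vecE uf.
  by rewrite /GRing.scale /= mulr1 mulVf // f0.
exists (fun x => (f (s x))^-1) => x Ux Vx.
have Vs : V (ms_proj N (s x)) by rewrite E.
split; [|by rewrite invr_eq0 f0 | exact: natE].
apply: hol_at_inv; last exact: f0.
apply: (@hol_map_at_comp _ _ _ _ s f); [exact: stable_chart | exact: hs |].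
by have [] := hf (s x) (conj Vs I).
Qed.

(** [u v'] sends the transported vector of [v] to the inverse of the character, so rescaling by the
    character gives the unique vector sent to 1. *)
Lemma nat_frame_act (n : int) :
  (forall (v v' : stable_space R theta d) (h : gauge R d),
      in_gauge h -> set_val v' = act (set_val v) h ->
      forall (E : ms_proj N v = ms_proj N v') (l : F (ms_proj N v)),
        u v' (ecast x (F x) E l) = (gauge_char theta n h)^-1 * u v l) ->
  forall (v v' : stable_space R theta d) (h : gauge R d) (x : N)
    (E : ms_proj N v = x) (E' : ms_proj N v' = x),
    in_gauge h -> set_val v' = act (set_val v) h ->
    nat_frame E' = gauge_char theta n h *: nat_frame E.
Proof.
move=> hu v v' h x E E' hh hv'; case: x / E' E => E.
have [g gK _] := lb_map_bij u v'.
apply: (can_inj gK); rewrite linearZ /nat_frame /= (hu v v' h) // !nat_vecE.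
by rewrite /GRing.scale /= mulr1 mulfV // gauge_char_neq0.
Qed.

End NaturalFrames.

(** * Linearity of the tensor map in the pair of representations *)

Section TensorLinear.
Local Open Scope classical_set_scope.
Context {R : realType} {Q Q' : quiver}.
Context {d : vert Q -> nat} {d' : vert Q' -> nat}.
Local Notation C := (cplx R).

Definition tensor_vecl (v : rep_space R d) : rep_space R (product_dim d d') :=
  tensor_vec v 0.

Definition tensor_vecr (w : rep_space R d') : rep_space R (product_dim d d') :=
  tensor_vec 0 w.

(** Each arrow of the product quiver sees only one of the two representations, so [tensor_vec] is a
    sum of two linear maps rather than a bilinear map. *)
Lemma tensor_vec_split (v : rep_space R d) (w : rep_space R d') :
  tensor_vec v w = tensor_vecl v + tensor_vecr w.
Proof.
apply/rowP => k; rewrite !mxE; case: (enum_val k) => -[p|p] [i j] /=.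
  by rewrite !mxE mulr0 add0r.
by rewrite !mxE mul0r addr0.
Qed.

Fact tensor_vecl_linear : linear tensor_vecl.
Proof.
move=> a v w; apply/rowP => k; rewrite !mxE; case: (enum_val k) => -[p|p] [i j] /=.
  by rewrite !mxE !mulr0 addr0.
by rewrite !mxE mulrDl mulrA.
Qed.

Fact tensor_vecr_linear : linear tensor_vecr.
Proof.
move=> a v w; apply/rowP => k; rewrite !mxE; case: (enum_val k) => -[p|p] [i j] /=.
  by rewrite !mxE mulrDr mulrCA.
by rewrite !mxE !mul0r mulr0 addr0.
Qed.

HB.instance Definition _ := GRing.isLinear.Build C _ _ _ _ tensor_vecl_linear.
HB.instance Definition _ := GRing.isLinear.Build C _ _ _ _ tensor_vecr_linear.

Lemma hol_at_tensor_vec (M : charted_space R)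
    (f : M -> rep_space R d) (g : M -> rep_space R d') (x : M) :
  hol_at f x -> hol_at g x -> hol_at (fun y => tensor_vec (f y) (g y)) x.
Proof.
move=> hf hg; have -> : (fun y => tensor_vec (f y) (g y)) =
    (fun y => tensor_vecl (f y) + tensor_vecr (g y)).
  by apply/funext => y; exact: tensor_vec_split.
by apply: hol_at_add; exact: hol_at_linear.
Qed.

Lemma continuous_tensor_vec (M : topologicalType)
    (f : M -> rep_space R d) (g : M -> rep_space R d') (x : M) :
  {for x, continuous f} -> {for x, continuous g} ->
  {for x, continuous (fun y => tensor_vec (f y) (g y))}.
Proof.
move=> cf cg; have -> : (fun y => tensor_vec (f y) (g y)) =
    (fun y => tensor_vecl (f y) + tensor_vecr (g y)).
  by apply/funext => y; exact: tensor_vec_split.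
by apply: cvgD; (apply: continuous_comp => //;
  exact/differentiable_continuous/differentiable_rV_linear).
Qed.

End TensorLinear.

(** * Gluing natural frames over the product of the moduli spaces *)

Theorem proposition3p3 (R : realType) (Q Q' : quiver)
    (theta : vert Q -> rat) (theta' : vert Q' -> rat)
    (d : vert Q -> nat) (d' : vert Q' -> nat)
    (d_gt0 : forall a, (0 < d a)%N) (d'_gt0 : forall a, (0 < d' a)%N)
    (d_coprime : coprime_dim d) (d_theta_coprime : theta_coprime theta d)
    (d'_coprime : coprime_dim d') (d'_theta_coprime : theta_coprime theta' d')
    (dbar_coprime :
       theta_coprime (product_weight theta theta') (product_dim d d'))
    (N1 : moduli_space R theta d) (N2 : moduli_space R theta' d')
    (N3 : moduli_space R (product_weight theta theta') (product_dim d d'))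
    (n n' : int)
    (n_int : forall a, n%:~R * (slope theta d - theta a) \is a Num.int)
    (n'_int : forall a, n'%:~R * (slope theta' d' - theta' a) \is a Num.int)
    (F1 : line_bundle N1) (F2 : line_bundle N2) (F3 : line_bundle N3)
    (F1_natural : is_natural_bundle n F1)
    (F2_natural : is_natural_bundle n' F2)
    (F3_natural : is_natural_bundle (n * n') F3)
    (phibar : hol_map (prod_space N1 N2) N3)
    (phibar_tensor : induced_by_tensor phibar) :
  lb_isomorphic (pullback phibar F3)
    (tensor_bundle
       (pullback (pr1 N1 N2) (tensor_exp F1 (n' * (rk d')%:Z)))
       (pullback (pr2 N1 N2) (tensor_exp F2 (n * (rk d)%:Z)))).

Proof.
have [u1 hu1] := F1_natural; have [u2 hu2] := F2_natural.
have [u3 hu3] := F3_natural.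
pose t v w := projT1 (cid (phibar_tensor v w)).
have tE v w : set_val (t v w) = tensor_vec (set_val v) (set_val w).
  exact: (projT2 (cid (phibar_tensor v w))).1.
have tP v w : phibar (ms_proj N1 v, ms_proj N2 w) = ms_proj N3 (t v w).
  exact: (projT2 (cid (phibar_tensor v w))).2.
(* An index is a pair of set-theoretic sections of the two quotient maps; [U i] below collects the
   points where both are holomorphic. *)
pose I := ({s : N1 -> stable_space R theta d | forall y, ms_proj N1 (s y) = y} *
  {s : N2 -> stable_space R theta' d' | forall y, ms_proj N2 (s y) = y})%type.
pose s1 (i : I) (z : prod_space N1 N2) := projT1 i.1 z.1.
pose s2 (i : I) (z : prod_space N1 N2) := projT1 i.2 z.2.
have E1 i z : ms_proj N1 (s1 i z) = pr1 N1 N2 z by exact: (projT2 i.1).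
have E2 i z : ms_proj N2 (s2 i z) = pr2 N1 N2 z by exact: (projT2 i.2).
have E3 i z : ms_proj N3 (t (s1 i z) (s2 i z)) = phibar z.
  by rewrite -tP E1 E2 -surjective_pairing.
pose U (i : I) : set (prod_space N1 N2) :=
  fun z => hol_map_at (projT1 i.1) z.1 /\ hol_map_at (projT1 i.2) z.2.
have hs1 i z : U i z -> hol_map_at (s1 i) z.
  move=> [h1 _]; apply: (hol_map_comp (F := pr1 N1 N2)) => //.
    exact: cm_cover.
  exact: hol_funP.
have hs2 i z : U i z -> hol_map_at (s2 i) z.
  move=> [_ h2]; apply: (hol_map_comp (F := pr2 N1 N2)) => //.
    exact: cm_cover.
  exact: hol_funP.
(* The points [t] are obtained by choice; they vary holomorphically because their underlying vectors
   are [tensor_vec] of holomorphic sections. *)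
have hst i z : U i z -> hol_map_at (fun z => t (s1 i z) (s2 i z)) z.
  move=> Uz; have h1 := hs1 i z Uz; have h2 := hs2 i z Uz.
  have tsE : (fun z => set_val (t (s1 i z) (s2 i z))) =
      (fun z => tensor_vec (set_val (s1 i z)) (set_val (s2 i z))).
    by apply/funext => y; exact: tE.
  apply: hol_map_sub_space; rewrite tsE.
    apply: continuous_tensor_vec; apply: continuous_comp;
      [exact: h1.1 | exact: initial_continuous
      |exact: h2.1 | exact: initial_continuous].
  by apply: hol_at_tensor_vec; exact: hol_at_set_val.
pose m1 := n' * (rk d')%:Z; pose m2 := n * (rk d)%:Z.
pose L1 := pullback (pr1 N1 N2) (tensor_exp F1 m1).
pose L2 := pullback (pr2 N1 N2) (tensor_exp F2 m2).
pose e1 i z : L1 z := exp_vec m1 (nat_frame u1 (E1 i z)).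
pose e2 i z : L2 z := exp_vec m2 (nat_frame u2 (E2 i z)).
pose e3 i z : pullback phibar F3 z := nat_frame u3 (E3 i z).
apply: (iso_of_frames (L' := tensor_bundle L1 L2) (U := U) (e := e3)
  (e' := fun i z => tens_vec (e1 i z) (e2 i z))).
- move=> z; have [s sE hs] := moduli_section z.1.
  have [s' sE' hs'] := moduli_section z.2.
  exists (exist _ s sE, exist _ s' sE').
  by near=> y; split; near: y; [exact: (cvg_fst hs)|exact: (cvg_snd hs')].
- move=> i; apply: (hol_frame_pullback (F := phibar)).
  by apply: hol_frame_nat => z; exact: hst.
- move=> i; apply: hol_frame_tens.
    apply: (hol_frame_pullback (F := pr1 N1 N2)); apply: hol_frame_exp.
    by apply: hol_frame_nat => z; exact: hs1.
  apply: (hol_frame_pullback (F := pr2 N1 N2)); apply: hol_frame_exp.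
  by apply: hol_frame_nat => z; exact: hs2.
(* Over one point, two choices of sections differ by gauge elements [h] and [h'], since [ms_orbit]
   identifies fibres with orbits. *)
move=> i j z _ _.
have [h hh hE] : exists2 h : gauge R d, in_gauge h &
    set_val (s1 j z) = act (set_val (s1 i z)) h.
  by apply/(ms_orbit N1 (s1 i z) (s1 j z)); rewrite !E1.
have [h' hh' hE'] : exists2 h' : gauge R d', in_gauge h' &
    set_val (s2 j z) = act (set_val (s2 i z)) h'.
  by apply/(ms_orbit N2 (s2 i z) (s2 j z)); rewrite !E2.
(* Both frames scale by this value: [e3] directly, the tensor of [e1] and [e2] through
   [gauge_char_tensor]. *)
exists (gauge_char (product_weight theta theta') (n * n') (tensor_gauge h h')).
split.
  apply: nat_frame_act => //; first exact: tensor_in_gauge.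
  by rewrite !tE hE hE' tensor_vec_act.
rewrite /e1 /e2 (nat_frame_act hu1 (E1 i z) (E1 j z) hh hE).
rewrite (nat_frame_act hu2 (E2 i z) (E2 j z) hh' hE').
rewrite !exp_vecZ ?gauge_char_neq0 ?nat_frame_neq0 //.
rewrite tens_vecZ ?gauge_char_tensor //.
  by rewrite expfz_neq0 ?gauge_char_neq0.
by apply: exp_vec_neq0; exact: nat_frame_neq0.
Unshelve. all: by end_near. Qed.
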